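(* Let $\widehat{\boldsymbol\mu}\in\Gamma$. Then the constrained estimator $\widehat{\boldsymbol\mu}^{C}(\widehat{\boldsymbol\mu},\mathbf t)$ is admissible in $\Gamma_C$ in terms of the risk $R(\boldsymbol\mu,\cdot)$ if and only if $\widehat{\boldsymbol\mu}$ is admissible in $\Gamma$ in terms of the risk $R_1(\boldsymbol\mu,\cdot)$.
   Context: Model: $\mathbf y=\boldsymbol\mu+\boldsymbol\epsilon$, where $\mathbf y,\boldsymbol\mu,\boldsymbol\epsilon\in\mathbb R^k$, $\boldsymbol\mu$ is an unknown mean vector and $\boldsymbol\epsilon$ is a random error vector (normality is not assumed). $E[\cdot\,|\,\boldsymbol\mu]$ is expectation over $\mathbf y$ for given $\boldsymbol\mu$. $\mathbf Q$ is a fixed $k\times k$ (symmetric) positive definite matrix; $\mathbf W$ is a fixed $k\times m$ matrix of rank $m$, $m<k$; $\mathbf t=\mathbf t(\mathbf y)$ is a given function from $\mathbb R^k$ to $\mathbb R^m$, with finite second moments given $\boldsymbol\mu$. The benchmark constraint is $\mathbf W'\widehat{\boldsymbol\mu}=\mathbf t(\mathbf y)$. $\Gamma$ is the class of estimators $\widehat{\boldsymbol\mu}=\widehat{\boldsymbol\mu}(\mathbf y)$ of $\boldsymbol\mu$ with $E[\widehat{\boldsymbol\mu}'\widehat{\boldsymbol\mu}\,|\,\boldsymbol\mu]<\infty$. The constrained estimator based on $\widehat{\boldsymbol\mu}$ is $$\widehat{\boldsymbol\mu}^{C}(\widehat{\boldsymbol\mu},\mathbf t)=\widehat{\boldsymbol\mu}+\mathbf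 Q^{-1}\mathbf W(\mathbf W'\mathbf Q^{-1}\mathbf W)^{-1}\{\mathbf t(\mathbf y)-\mathbf W'\widehat{\boldsymbol\mu}\},$$ $\Gamma_C=\{\widehat{\boldsymbol\mu}^{C}(\widehat{\boldsymbol\mu},\mathbf t)\,|\,\widehat{\boldsymbol\mu}\in\Gamma\}$, and $\mathbf P_{\mathbf W}=\mathbf Q^{-1}\mathbf W(\mathbf W'\mathbf Q^{-1}\mathbf W)^{-1}\mathbf W'$. The risks are $$R(\boldsymbol\mu,\widehat{\boldsymbol\mu})=E[(\widehat{\boldsymbol\mu}-\boldsymbol\mu)'\mathbf Q(\widehat{\boldsymbol\mu}-\boldsymbol\mu)\,|\,\boldsymbol\mu],\qquad R_1(\boldsymbol\mu,\widehat{\boldsymbol\mu})=E[(\widehat{\boldsymbol\mu}-\boldsymbol\mu)'\mathbf Q(\mathbf I-\mathbf P_{\mathbf W})(\widehat{\boldsymbol\mu}-\boldsymbol\mu)\,|\,\boldsymbol\mu].$$ An estimator in a class is admissible in that class in terms of a risk if no estimator in the class has risk no larger for all $\boldsymbol\mu$ and strictly smaller for some $\boldsymbol\mu$. *)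

(* Defs.v *)
From HB Require Import structures.
From mathcomp Require Import all_boot all_order all_algebra.
From mathcomp Require Import all_classical all_reals all_analysis.

Set Implicit Arguments.
Unset Strict Implicit.
Unset Printing Implicit Defensive.

Import Order.TTheory GRing.Theory Num.Theory.
Import numFieldNormedType.Exports.

Local Open Scope classical_set_scope.
Local Open Scope ring_scope.

(* R^n with its Borel sigma-algebra. *)
Definition borel_cV (R : realType) (n : nat) :=
  g_sigma_algebraType (@open 'cV[R]_n).

Definition quadform (R : realType) (n : nat) (A : 'M[R]_n) (x : 'cV[R]_n) : R :=
  (x^T *m A *m x) 0 0.

Definition sqnorm (R : realType) (n : nat) (x : 'cV[R]_n) : R :=
  (x^T *m x) 0 0.

Definition posdefmx (R : realType) (n : nat) (A : 'M[R]_n) : Prop :=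
  A^T = A /\ forall x : 'cV[R]_n, x != 0 -> 0 < quadform A x.

Definition proj_W (R : realType) (k m : nat) (Q : 'M[R]_k) (W : 'M[R]_(k, m)) :
    'M[R]_k :=
  invmx Q *m W *m invmx (W^T *m invmx Q *m W) *m W^T.

Definition constrained (R : realType) (k m : nat) (Q : 'M[R]_k)
    (W : 'M[R]_(k, m)) (t : 'cV[R]_k -> 'cV[R]_m)
    (muhat : 'cV[R]_k -> 'cV[R]_k) : 'cV[R]_k -> 'cV[R]_k :=
  fun y => muhat y +
    invmx Q *m W *m invmx (W^T *m invmx Q *m W) *m (t y - W^T *m muhat y).

(* Expectation of [g y] for given [mu], where [y = mu + eps].  The law of the
   error [eps] under [P mu] is arbitrary and may depend on [mu]; a law free of
   [mu] is the case of a constant family [P]. *)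
Definition expect_given (R : realType) (d : measure_display)
    (T : measurableType d) (k : nat) (P : 'cV[R]_k -> probability T R)
    (eps : T -> 'cV[R]_k) (mu : 'cV[R]_k) (g : 'cV[R]_k -> R) : \bar R :=
  ('E_(P mu)[fun w => g (mu + eps w)%R])%E.

(* Borel functions [f] of [y] with [E[f(y)'f(y) | mu]] finite for every [mu]. *)
Definition square_integrable (R : realType) (d : measure_display)
    (T : measurableType d) (k n : nat) (P : 'cV[R]_k -> probability T R)
    (eps : T -> 'cV[R]_k) (f : 'cV[R]_k -> 'cV[R]_n) : Prop :=
  measurable_fun [set: borel_cV R k] (f : borel_cV R k -> borel_cV R n) /\
  forall mu : 'cV[R]_k,
    (expect_given P eps mu (fun y => sqnorm (f y)) < +oo)%E.

Definition Gamma (R : realType) (d : measure_display) (T : measurableType d)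
    (k : nat) (P : 'cV[R]_k -> probability T R) (eps : T -> 'cV[R]_k) :
    set ('cV[R]_k -> 'cV[R]_k) :=
  [set muhat | square_integrable P eps muhat].

Definition Gamma_C (R : realType) (d : measure_display) (T : measurableType d)
    (k m : nat) (P : 'cV[R]_k -> probability T R) (eps : T -> 'cV[R]_k)
    (Q : 'M[R]_k) (W : 'M[R]_(k, m)) (t : 'cV[R]_k -> 'cV[R]_m) :
    set ('cV[R]_k -> 'cV[R]_k) :=
  [set constrained Q W t muhat | muhat in Gamma P eps].

Definition risk (R : realType) (d : measure_display) (T : measurableType d)
    (k : nat) (P : 'cV[R]_k -> probability T R) (eps : T -> 'cV[R]_k)
    (Q : 'M[R]_k) (mu : 'cV[R]_k) (muhat : 'cV[R]_k -> 'cV[R]_k) : \bar R :=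
  expect_given P eps mu (fun y => quadform Q (muhat y - mu)).

Definition risk1 (R : realType) (d : measure_display) (T : measurableType d)
    (k m : nat) (P : 'cV[R]_k -> probability T R) (eps : T -> 'cV[R]_k)
    (Q : 'M[R]_k) (W : 'M[R]_(k, m)) (mu : 'cV[R]_k)
    (muhat : 'cV[R]_k -> 'cV[R]_k) : \bar R :=
  expect_given P eps mu
    (fun y => quadform (Q *m (1%:M - proj_W Q W)) (muhat y - mu)).

Definition admissible (R : realType) (k : nat)
    (C : set ('cV[R]_k -> 'cV[R]_k))
    (rho : 'cV[R]_k -> ('cV[R]_k -> 'cV[R]_k) -> \bar R)
    (delta : 'cV[R]_k -> 'cV[R]_k) : Prop :=
  C delta /\
  ~ (exists delta' : 'cV[R]_k -> 'cV[R]_k,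
      [/\ C delta',
          (forall mu, (rho mu delta' <= rho mu delta)%E) &
          (exists mu, (rho mu delta' < rho mu delta)%E)]).

(* Main.v *)
Require Import Defs.
From HB Require Import structures.
From mathcomp Require Import all_boot all_order all_algebra.
From mathcomp Require Import all_classical all_reals all_analysis.
From mathcomp Require Import measurable_realfun ring lra.

Set Implicit Arguments.
Unset Strict Implicit.
Unset Printing Implicit Defensive.

Import Order.TTheory GRing.Theory Num.Theory.
Import numFieldNormedType.Exports.
Local Open Scope classical_set_scope.
Local Open Scope ring_scope.

(** The matrix [P_W] is the [Q]-orthogonal projection onto the range of
    [Q^-1 W], so the error of a constrained estimator splits into two
    [Q]-orthogonal parts:
      [muhat^C - mu = (I - P_W) (muhat - mu)
                      + Q^-1 W (W' Q^-1 W)^-1 (t(y) - W' mu)].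
    The loss of the first part is the loss of [muhat] in [risk1]; the loss of
    the second part, the quadratic form of [(W' Q^-1 W)^-1] at [t(y) - W' mu],
    does not involve [muhat] ([quadform_constrained]).  Taking expectations,
      [R(mu, muhat^C) = R_1(mu, muhat) + c(mu)]
    ([risk_constrained]), where [c(mu)] is common to all estimators and finite
    because [t] has second moments ([expect_quadform_fin]).  A finite constant
    cancels in comparisons, even between infinite risks, so [delta] dominates
    [muhat] for [R_1] exactly when [delta^C] dominates [muhat^C] for [R].  Since
    [Gamma_C] is the image of [Gamma] under [delta |-> delta^C], the two notions
    of admissibility coincide.

    Risks take values in the extended reals, so the expectation of the sum is
    split by additivity of integrals of nonnegative measurable functions; this
    is why nonnegativity and Borel measurability of the two losses are proved
    here. *)

(** * Bounds on quadratic forms *)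

Lemma quadformE (R : realType) (n : nat) (A : 'M[R]_n) (x : 'cV[R]_n) :
  quadform A x = \sum_i \sum_j x i 0 * A i j * x j 0.
Proof.
rewrite /quadform mxE exchange_big/=; apply: eq_bigr => j _.
by rewrite mxE mulr_suml; apply: eq_bigr => i _; rewrite mxE.
Qed.

Lemma quadform0 (R : realType) (n : nat) (A : 'M[R]_n) : quadform A 0 = 0.
Proof. by rewrite /quadform mulmx0 mxE. Qed.

Lemma sqnorm_quadform (R : realType) (n : nat) (x : 'cV[R]_n) :
  sqnorm x = quadform 1%:M x.
Proof. by rewrite /quadform mulmx1. Qed.

Lemma sqnormE (R : realType) (n : nat) (x : 'cV[R]_n) :
  sqnorm x = \sum_i x i 0 ^+ 2.
Proof. by rewrite /sqnorm mxE; apply: eq_bigr => i _; rewrite mxE expr2. Qed.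

Lemma sqnorm_ge0 (R : realType) (n : nat) (x : 'cV[R]_n) : 0 <= sqnorm x.
Proof. by rewrite sqnormE; apply: sumr_ge0 => i _; exact: sqr_ge0. Qed.

Lemma coord_sqr_le_sqnorm (R : realType) (n : nat) (x : 'cV[R]_n) (i : 'I_n) :
  x i 0 ^+ 2 <= sqnorm x.
Proof.
rewrite sqnormE (bigD1 i)//= lerDl.
by apply: sumr_ge0 => j _; exact: sqr_ge0.
Qed.

Lemma sqnormB_le (R : realType) (n : nat) (x y : 'cV[R]_n) :
  sqnorm (x - y) <= 2 * sqnorm x + 2 * sqnorm y.
Proof.
rewrite !sqnormE !mulr_sumr -big_split/=; apply: ler_sum => i _.
rewrite !mxE; have := sqr_ge0 (x i 0 + y i 0); nra.
Qed.

(** Each monomial is controlled by [2 |x_i| |x_j| <= x_i ^ 2 + x_j ^ 2]; the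
    crude constant suffices since only finiteness of expectations is at
    stake. *)
Lemma quadform_le_sqnorm (R : realType) (n : nat) (A : 'M[R]_n)
    (x : 'cV[R]_n) :
  quadform A x <= (\sum_i \sum_j `|A i j|) * sqnorm x.
Proof.
rewrite quadformE mulr_suml; apply: ler_sum => i _.
rewrite mulr_suml; apply: ler_sum => j _.
apply: le_trans (ler_norm _) _.
rewrite mulrAC normrM mulrC; apply: ler_wpM2l => //.
have := coord_sqr_le_sqnorm x i; have := coord_sqr_le_sqnorm x j.
have := sqr_ge0 (`|x i 0| - `|x j 0|).
rewrite normrM -(real_normK (num_real (x i 0))).
rewrite -(real_normK (num_real (x j 0))).
nra.
Qed.

(** * Positive definite matrices *)

Lemma posdefmx_unit (R : realType) (n : nat) (A : 'M[R]_n) :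
  posdefmx A -> A \in unitmx.
Proof.
move=> [_ A0]; rewrite -row_free_unit; apply: inj_row_free => v vA0.
apply/eqP/negPn/negP => v0.
have := A0 v^T; rewrite /quadform trmxK vA0 mul0mx mxE ltxx trmx_eq0.
by move=> /(_ v0).
Qed.

Lemma posdefmx_inv (R : realType) (n : nat) (A : 'M[R]_n) :
  posdefmx A -> posdefmx (invmx A).
Proof.
move=> Apd; have Au := posdefmx_unit Apd; case: Apd => AT A0.
have iAT : (invmx A)^T = invmx A by rewrite trmx_inv AT.
split=> // x x0.
have -> : quadform (invmx A) x = quadform A (invmx A *m x).
  by rewrite /quadform trmx_mul iAT mulmxKV // mulmxA.
apply: A0; apply: contraNneq x0 => iAx0.
by rewrite -(mulKVmx Au x) iAx0 mulmx0.
Qed.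

Lemma posdefmx_ge0 (R : realType) (n : nat) (A : 'M[R]_n) (x : 'cV[R]_n) :
  posdefmx A -> 0 <= quadform A x.
Proof.
move=> [_ A0]; have [->|/A0/ltW//] := eqVneq x 0.
by rewrite quadform0.
Qed.

(** The rank condition makes [x |-> W x] injective, so definiteness survives
    the restriction of the form to the range of [W]. *)
Lemma posdefmx_congr (R : realType) (k m : nat) (A : 'M[R]_k)
    (W : 'M[R]_(k, m)) :
  posdefmx A -> \rank W = m -> posdefmx (W^T *m A *m W).
Proof.
move=> [AT A0] Wm; split; first by rewrite !trmx_mul trmxK AT mulmxA.
move=> x x0.
have -> : quadform (W^T *m A *m W) x = quadform A (W *m x).
  by rewrite /quadform trmx_mul !mulmxA.
apply: A0; apply: contra x0 => /eqP Wx0.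
have WTfree : row_free W^T by rewrite /row_free mxrank_tr Wm.
rewrite -trmx_eq0; apply/eqP/(row_free_inj WTfree).
by rewrite mul0mx -trmx_mul Wx0 trmx0.
Qed.

(** * Orthogonal decomposition of the constrained loss *)

Lemma quadform_orthoD (R : realType) (n : nat) (A : 'M[R]_n)
    (a b : 'cV[R]_n) :
  A^T = A -> a^T *m A *m b = 0 ->
  quadform A (a + b) = quadform A a + quadform A b.
Proof.
move=> AT ab; have ba : b^T *m A *m a = 0.
  by apply: trmx_inj; rewrite !trmx_mul trmxK AT mulmxA ab trmx0.
rewrite /quadform [(a + b)^T]raddfD/= mulmxDl mulmxDl !mulmxDr ab ba.
by rewrite addr0 add0r mxE.
Qed.

(** Pythagoras for the inner product of [Q].  With
    [G = Q^-1 W (W' Q^-1 W)^-1], everything follows from [W' G = I]: it gives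
    [W' (I - G W') = 0], which kills the cross term, because
    [Q G = W (W' Q^-1 W)^-1]. *)
Lemma quadform_constrained (R : realType) (k m : nat) (Q : 'M[R]_k)
    (W : 'M[R]_(k, m)) (t : 'cV[R]_k -> 'cV[R]_m)
    (muhat : 'cV[R]_k -> 'cV[R]_k) (y mu : 'cV[R]_k) :
  posdefmx Q -> \rank W = m ->
  quadform Q (constrained Q W t muhat y - mu) =
  quadform (Q *m (1%:M - proj_W Q W)) (muhat y - mu) +
  quadform (invmx (W^T *m invmx Q *m W)) (t y - W^T *m mu).
Proof.
move=> Qpd Wm; have Qu := posdefmx_unit Qpd; have [QT _] := Qpd.
have Mpd := posdefmx_congr (posdefmx_inv Qpd) Wm.
have Mu := posdefmx_unit Mpd; have [iMT _] := posdefmx_inv Mpd.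
rewrite /constrained /proj_W.
set M := W^T *m invmx Q *m W in Mpd Mu iMT *.
set G := invmx Q *m W *m invmx M.
have QG : Q *m G = W *m invmx M by rewrite /G !mulmxA mulmxV// mul1mx.
have GQ : G^T *m Q = invmx M *m W^T.
  by rewrite -[Q in LHS]QT -trmx_mul QG trmx_mul iMT.
have WG : W^T *m G = 1%:M by rewrite /G !mulmxA -/M mulmxV.
(* The body of [G] is forgotten so that associativity does not split it. *)
move: G QG GQ WG => G QG GQ WG.
have WP : W^T *m (1%:M - G *m W^T) = 0.
  by rewrite mulmxBr mulmx1 mulmxA WG mul1mx subrr.
have PTW : (1%:M - G *m W^T)^T *m W = 0.
  by rewrite -[in X in _ *m X](trmxK W) -trmx_mul WP trmx0.
(* [I - G W'] is a [Q]-selfadjoint idempotent. *)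
have PQP : (1%:M - G *m W^T)^T *m Q *m (1%:M - G *m W^T) =
    Q *m (1%:M - G *m W^T).
  rewrite [(_ - _)^T]raddfB/= trmx1 trmx_mul trmxK mulmxBl mul1mx -mulmxA GQ.
  by rewrite mulmxBl -!mulmxA WP !mulmx0 subr0.
have -> : muhat y + G *m (t y - W^T *m muhat y) - mu =
    (1%:M - G *m W^T) *m (muhat y - mu) + G *m (t y - W^T *m mu).
  rewrite mulmxBl mul1mx -!mulmxA !mulmxBr.
  move: (G *m t y) (G *m (W^T *m muhat y)) (G *m (W^T *m mu)) => a b c.
  by apply/colP => i; rewrite !mxE; ring.
move: (muhat y - mu) (t y - W^T *m mu) => v s.
rewrite (@quadform_orthoD _ _ Q)//; last first.
  rewrite trmx_mul mulmxA -(mulmxA _ Q G) QG mulmxA -(mulmxA v^T) PTW.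
  by rewrite mulmx0 !mul0mx.
rewrite /quadform !(trmx_mul _ v, trmx_mul _ s).
congr (_ + _); congr (fun_of_matrix _ _ _).
  by rewrite -!(mulmxA v^T) -PQP !mulmxA.
by rewrite -(mulmxA s^T) GQ -!mulmxA (mulmxA W^T) WG mul1mx.
Qed.

(** With [t = 0], [mu = 0] and the identity as estimator, the decomposition
    displays the loss of [risk1] as a value of the positive form of [Q]. *)
Lemma quadform_risk1_ge0 (R : realType) (k m : nat) (Q : 'M[R]_k)
    (W : 'M[R]_(k, m)) (x : 'cV[R]_k) :
  posdefmx Q -> \rank W = m ->
  0 <= quadform (Q *m (1%:M - proj_W Q W)) x.
Proof.
move=> Qpd Wm.
have := quadform_constrained (fun=> 0) id x 0 Qpd Wm.
by rewrite mulmx0 !subr0 quadform0 addr0 => <-; exact: posdefmx_ge0.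
Qed.

(** * Measurability and moments of the losses *)

Lemma quadform_continuous (R : realType) (n : nat) (A : 'M[R]_n)
    (c : 'cV[R]_n) : continuous (fun x : 'cV[R]_n => quadform A (x - c)).
Proof.
have coordB l : continuous (fun x : 'cV[R]_n => (x - c) l 0).
  have -> : (fun x : 'cV[R]_n => (x - c) l 0) = (fun x => x l 0 - c l 0).
    by apply/funext => x; rewrite !mxE.
  move=> x; apply: (@continuousB R R _ (fun y : 'cV[R]_n => y l 0) (cst _)).
    exact: coord_continuous.
  exact: cst_continuous.
under eq_fun do rewrite quadformE.
apply: continuous_big => [|i _]; first exact: add_continuous.
apply: continuous_big => [|j _]; first exact: add_continuous.
move=> x.
have cA : {for x, continuous (cst (A i j) : 'cV[R]_n -> R)}.
  exact: cst_continuous.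
exact: (continuousM (continuousM (coordB i x) cA) (coordB j x)).
Qed.

Lemma borel_continuous_measurable (R : realType) (n p : nat)
    (f : 'cV[R]_n -> 'cV[R]_p) : continuous f ->
  measurable_fun [set: borel_cV R n] (f : borel_cV R n -> borel_cV R p).
Proof.
move=> /continuousP cf.
apply: (@measurability _ _ (borel_cV R n) (borel_cV R p) _ _ open erefl).
move=> _ [B oB <-]; rewrite setTI; apply: sub_sigma_algebra.
exact: cf.
Qed.

Lemma borel_continuous_measurableR (R : realType) (n : nat)
    (f : 'cV[R]_n -> R) : continuous f ->
  measurable_fun [set: borel_cV R n] (f : borel_cV R n -> R).
Proof.
move=> /continuousP cf.
apply: (measurability _ (RGenOpens.measurableE R)) => //.
move=> _ [_ [a [b ->]] <-]; rewrite setTI; apply: sub_sigma_algebra.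
by apply: cf; exact: interval_open.
Qed.

Section Expectation.
Context (R : realType) (d : measure_display) (T : measurableType d) (k : nat).
Variables (P : 'cV[R]_k -> probability T R) (eps : {mfun T >-> borel_cV R k}).

Lemma quadform_obs_measurable (n : nat) (A : 'M[R]_n)
    (f : 'cV[R]_k -> 'cV[R]_n) (c : 'cV[R]_n) (mu : 'cV[R]_k) :
  measurable_fun [set: borel_cV R k] (f : borel_cV R k -> borel_cV R n) ->
  measurable_fun [set: T]
    (fun w => (quadform A (f (mu + eps w)%R - c))%:E).
Proof.
move=> mf; apply/measurable_EFinP.
have mobs : measurable_fun [set: T] (fun w => (mu + eps w : borel_cV R k)).
  apply: (measurableT_comp
    (f := fun x : borel_cV R k => (mu + x : borel_cV R k))).
    apply: borel_continuous_measurable => x.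
    have cmu : {for x, continuous (cst mu : 'cV[R]_k -> 'cV[R]_k)}.
      exact: cst_continuous.
    have cid : {for x, continuous (id : 'cV[R]_k -> 'cV[R]_k)} by exact: cvg_id.
    exact: (@continuousD R 'cV[R]_k 'cV[R]_k _ _ x cmu cid).
  exact: measurable_funPT.
apply: (measurableT_comp (f := fun x : borel_cV R n => quadform A (x - c))).
  by apply: borel_continuous_measurableR; exact: quadform_continuous.
exact: measurableT_comp mf mobs.
Qed.

(** The quadratic form of [f - c] is at most [2 K (f' f + c' c)], whose
    expectation is finite under a probability measure. *)
Lemma expect_quadform_fin (n : nat) (A : 'M[R]_n)
    (f : 'cV[R]_k -> 'cV[R]_n) (c : 'cV[R]_n) (mu : 'cV[R]_k) :
  posdefmx A -> square_integrable P eps f ->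
  expect_given P eps mu (fun y => quadform A (f y - c)) \is a fin_num.
Proof.
move=> Apd [mf /(_ mu)]; rewrite /expect_given !unlock => fsq.
have A0 w : (0 <= (quadform A (f (mu + eps w)%R - c))%:E)%E.
  by rewrite lee_fin; exact: posdefmx_ge0.
rewrite ge0_fin_numE; last exact: integral_ge0.
set K : R := \sum_i \sum_j `|A i j|.
have K0 : 0 <= K by apply: sumr_ge0 => i _; apply: sumr_ge0.
have mnorm : measurable_fun [set: T] (fun w => (sqnorm (f (mu + eps w)%R))%:E).
  under eq_fun do rewrite sqnorm_quadform -[f _]subr0.
  exact: quadform_obs_measurable.
have mKnorm : measurable_fun [set: T]
    (fun w => ((2 * K)%:E * (sqnorm (f (mu + eps w)%R))%:E)%E).
  exact: measurable_funeM.
have K20 : 0 <= 2 * K by rewrite mulr_ge0.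
have KN0 w : (0 <= (2 * K)%:E * (sqnorm (f (mu + eps w)%R))%:E)%E.
  by rewrite -EFinM lee_fin mulr_ge0// sqnorm_ge0.
have Kc0 : (0 <= (2 * K * sqnorm c)%:E)%E.
  by rewrite lee_fin mulr_ge0// sqnorm_ge0.
apply: (@le_lt_trans _ _ (\int[P mu]_w
  ((2 * K)%:E * (sqnorm (f (mu + eps w)%R))%:E
   + cst (2 * K * sqnorm c)%:E w))%E).
  apply: ge0_le_integral => //.
  - exact: quadform_obs_measurable.
  - by apply: emeasurable_funD.
  - move=> w _; rewrite -EFinM -EFinD lee_fin.
    apply: le_trans (quadform_le_sqnorm _ _) _; rewrite -/K.
    apply: le_trans (ler_wpM2l K0 (sqnormB_le _ _)) _.
    by rewrite le_eqVlt; apply/orP; left; apply/eqP; ring.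
rewrite ge0_integralD//; apply: lte_add_pinfty.
  rewrite ge0_integralZl//; last by move=> w _; rewrite lee_fin sqnorm_ge0.
  by rewrite lte_mul_pinfty// lee_fin.
have := expectation_cst (P mu) (2 * K * sqnorm c).
by rewrite unlock => ->; rewrite ltry.
Qed.

Lemma risk_constrained (m : nat) (Q : 'M[R]_k) (W : 'M[R]_(k, m))
    (t : 'cV[R]_k -> 'cV[R]_m) (muhat : 'cV[R]_k -> 'cV[R]_k)
    (mu : 'cV[R]_k) :
  posdefmx Q -> \rank W = m ->
  square_integrable P eps t -> square_integrable P eps muhat ->
  (risk P eps Q mu (constrained Q W t muhat) =
   risk1 P eps Q W mu muhat +
   expect_given P eps mu
     (fun y => quadform (invmx (W^T *m invmx Q *m W)) (t y - W^T *m mu)))%E.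
Proof.
move=> Qpd Wm [mt _] [mmuhat _].
have iMpd := posdefmx_inv (posdefmx_congr (posdefmx_inv Qpd) Wm).
rewrite /risk /risk1 /expect_given !unlock -ge0_integralD//.
- by apply: eq_integral => w _; rewrite -EFinD quadform_constrained.
- by move=> w _; rewrite lee_fin; exact: quadform_risk1_ge0.
- exact: quadform_obs_measurable.
- by move=> w _; rewrite lee_fin; exact: posdefmx_ge0.
- exact: quadform_obs_measurable.
Qed.

End Expectation.

(** * Equivalence of the two admissibility notions *)

Theorem proposition2p2 (R : realType) (k m : nat) (m_lt_k : (m < k)%N)
  (d : measure_display) (T : measurableType d)
  (P : 'cV[R]_k -> probability T R) (eps : {mfun T >-> borel_cV R k})
  (Q : 'M[R]_k) (Q_posdef : posdefmx Q)
  (W : 'M[R]_(k, m)) (W_rank : \rank W = m)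
  (t : 'cV[R]_k -> 'cV[R]_m) (t_sqint : square_integrable P eps t)
  (muhat : 'cV[R]_k -> 'cV[R]_k) (muhat_Gamma : Gamma P eps muhat) :
  admissible (Gamma_C P eps Q W t) (risk P eps Q) (constrained Q W t muhat) <->
  admissible (Gamma P eps) (risk1 P eps Q W) muhat.
Proof.
have iMpd := posdefmx_inv (posdefmx_congr (posdefmx_inv Q_posdef) W_rank).
have fin mu := expect_quadform_fin (W^T *m mu) mu iMpd t_sqint.
have riskC delta mu : Gamma P eps delta -> _ :=
  risk_constrained mu Q_posdef W_rank t_sqint.
have le_risk delta mu : Gamma P eps delta ->
    (risk P eps Q mu (constrained Q W t delta) <=
     risk P eps Q mu (constrained Q W t muhat))%E =
    (risk1 P eps Q W mu delta <= risk1 P eps Q W mu muhat)%E.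
  by move=> Gdelta; rewrite !riskC// leeD2rE.
have lt_risk delta mu : Gamma P eps delta ->
    (risk P eps Q mu (constrained Q W t delta) <
     risk P eps Q mu (constrained Q W t muhat))%E =
    (risk1 P eps Q W mu delta < risk1 P eps Q W mu muhat)%E.
  by move=> Gdelta; rewrite !riskC// lteD2rE.
split=> -[_ undominated]; split=> //.
- move=> [delta [Gdelta le_delta [mu lt_delta]]]; apply: undominated.
  exists (constrained Q W t delta); split; first by exists delta.
    by move=> nu; rewrite le_risk.
  by exists mu; rewrite lt_risk.
- by exists muhat.
- move=> [_ [[delta Gdelta <-] le_delta [mu lt_delta]]]; apply: undominated.
  exists delta; split=> // [nu|]; first by rewrite -le_risk.
  by exists mu; rewrite -lt_risk.
Qed.
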